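(* Let $T:V\to\mathfrak{g}$ be an $\mathcal{O}$-operator on a hom-Lie algebra $(\mathfrak{g},[\cdot,\cdot],\alpha)$ with respect to a representation $(V,\beta,\rho)$. Then the differentials $\delta_{\beta,\alpha}$ and $\{\!\!\{T,-\}\!\!\}$ on $C^*_{\beta,\alpha}(V,\mathfrak{g})$ are related by $$\delta_{\beta,\alpha}(P)=(-1)^n\{\!\!\{T,P\}\!\!\}\qquad\text{for all }P\in C^n_{\beta,\alpha}(V,\mathfrak{g}),\ n\ge1.$$
   Context: The base field $k$ has characteristic zero. A (multiplicative) hom-Lie algebra $(\mathfrak{g},[\cdot,\cdot],\alpha)$ is a vector space $\mathfrak{g}$ with a skew-symmetric bilinear bracket and a linear map $\alpha:\mathfrak{g}\to\mathfrak{g}$ with $\alpha[x,y]=[\alpha(x),\alpha(y)]$ and $[\alpha(x),[y,z]]+[\alpha(y),[z,x]]+[\alpha(z),[x,y]]=0$ for all $x,y,z$. A representation $(V,\beta,\rho)$ is a vector space $V$, $\beta\in\mathrm{End}(V)$ and a linear map $\rho:\mathfrak{g}\to\mathrm{End}(V)$ with $\rho(\alpha(x))(\beta(v))=\beta(\rho(x)(v))$ and $\rho([x,y])(\beta(v))=\rho(\alpha(x))\rho(y)(v)-\rho(\alpha(y))\rho(x)(v)$. Write $\{x,v\}:=\rho(x)(v)$. An $\mathcal{O}$-operator on $(\mathfrak{g},[\cdot,\cdot],\alpha)$ with respect to $(V,\beta,\rho)$ is a linear map $T:V\to\mathfrak{g}$ with $T\circ\beta=\alpha\circ T$ and $[Tu,Tv]=T(\{Tu,v\}-\{Tv,u\})$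 for all $u,v\in V$. For $n\ge1$, $C^n_{\beta,\alpha}(V,\mathfrak{g})$ is the space of linear maps $P:\wedge^nV\to\mathfrak{g}$ with $\alpha(P(v_1,\dots,v_n))=P(\beta(v_1),\dots,\beta(v_n))$. Let $S_{r_1,\dots,r_i}$ denote the set of $(r_1,\dots,r_i)$-shuffles in $S_{r_1+\cdots+r_i}$, and $(-1)^{|\tau|}$ the sign of $\tau$. For $P\in C^n_{\beta,\alpha}(V,\mathfrak{g})$, $Q\in C^m_{\beta,\alpha}(V,\mathfrak{g})$ the bracket $\{\!\!\{P,Q\}\!\!\}\in C^{n+m}_{\beta,\alpha}(V,\mathfrak{g})$ is $$\{\!\!\{P,Q\}\!\!\}(v_1,\dots,v_{n+m})=\sum_{\tau\in S_{m,1,n-1}}(-1)^{|\tau|}P\big(\{Q(v_{\tau(1)},\dots,v_{\tau(m)}),\beta^{m-1}(v_{\tau(m+1)})\},\beta^m(v_{\tau(m+2)}),\dots,\beta^m(v_{\tau(n+m)})\big)$$ $$+(-1)^{mn}\Big(\sum_{\tau\in S_{n,m}}(-1)^{|\tau|}\big[\alpha^{m-1}P(v_{\tau(1)},\dots,v_{\tau(n)}),\alpha^{n-1}Q(v_{\tau(n+1)},\dots,v_{\tau(n+m)})\big]$$ $$-\sum_{\tau\in S_{n,1,m-1}}(-1)^{|\tau|}Q\big(\{P(v_{\tau(1)},\dots,v_{\tau(n)}),\beta^{n-1}(v_{\tau(n+1)})\},\beta^n(v_{\tau(n+2)}),\dots,\beta^n(v_{\tau(n+m)})\big)\Big).$$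 The differential $\delta_{\beta,\alpha}:C^n_{\beta,\alpha}(V,\mathfrak{g})\to C^{n+1}_{\beta,\alpha}(V,\mathfrak{g})$ is the hom-Lie algebra coboundary of the sub-adjacent hom-Lie algebra $(V,[\cdot,\cdot]^c,\beta)$, $[v,w]^c=\{Tv,w\}-\{Tw,v\}$, with coefficients in the representation $(\mathfrak{g},\alpha,\rho_T)$, $\rho_T(v)(x)=[Tv,x]+T\{x,v\}$: $$\delta_{\beta,\alpha}P(v_1,\dots,v_{n+1})=\sum_{i=1}^{n+1}(-1)^{i+1}\rho_T(\beta^{n-1}(v_i))\big(P(v_1,\dots,\widehat{v_i},\dots,v_{n+1})\big)$$ $$+\sum_{i<j}(-1)^{i+j}P\big([v_i,v_j]^c,\beta(v_1),\dots,\widehat{\beta(v_i)},\dots,\widehat{\beta(v_j)},\dots,\beta(v_{n+1})\big).$$ *)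

(* Defs.v *)
From HB Require Import structures.
From mathcomp Require Import all_boot all_order perm all_algebra.

Set Implicit Arguments.
Unset Strict Implicit.
Unset Printing Implicit Defensive.

Import GRing.Theory.
Local Open Scope ring_scope.

Record homLie (k : fieldType) (g : lmodType k) := HomLie {
  hl_bracket : {bilinear g -> g -> g};
  hl_alpha : {linear g -> g};
  hl_skew : forall x y, hl_bracket x y = - hl_bracket y x;
  hl_mult : forall x y,
    hl_alpha (hl_bracket x y) = hl_bracket (hl_alpha x) (hl_alpha y);
  hl_jacobi : forall x y z,
    hl_bracket (hl_alpha x) (hl_bracket y z)
    + hl_bracket (hl_alpha y) (hl_bracket z x)
    + hl_bracket (hl_alpha z) (hl_bracket x y) = 0
}.

(* The linear map rho : g -> End(V) is given as the bilinear map
   (x, v) |-> {x, v} = rho(x)(v). *)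
Record homLieRep (k : fieldType) (g : lmodType k) (L : homLie g)
    (V : lmodType k) := HomLieRep {
  hr_beta : {linear V -> V};
  hr_rho : {bilinear g -> V -> V};
  hr_mult : forall x v,
    hr_rho (hl_alpha L x) (hr_beta v) = hr_beta (hr_rho x v);
  hr_act : forall x y v,
    hr_rho (hl_bracket L x y) (hr_beta v)
    = hr_rho (hl_alpha L x) (hr_rho y v) - hr_rho (hl_alpha L y) (hr_rho x v)
}.

Record Ooperator (k : fieldType) (g : lmodType k) (L : homLie g)
    (V : lmodType k) (M : homLieRep L V) := OOperator {
  oo_fun :> {linear V -> g};
  oo_comm : forall v, oo_fun (hr_beta M v) = hl_alpha L (oo_fun v);
  oo_bracket : forall u v,
    hl_bracket L (oo_fun u) (oo_fun v)
    = oo_fun (hr_rho M (oo_fun u) v - hr_rho M (oo_fun v) u)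
}.

(* C^n_{beta,alpha}(V, g): a linear map out of the n-th exterior power is
   given as an alternating multilinear map of n arguments. *)
Record cochain (k : fieldType) (V g : lmodType k)
    (beta : V -> V) (alpha : g -> g) (n : nat) := Cochain {
  coch_fun :> {ffun 'I_n -> V} -> g;
  coch_multilinear : forall (i : 'I_n) (v : {ffun 'I_n -> V}),
    linear (fun x : V => coch_fun (finfun [eta v with i |-> x]));
  coch_alternating : forall (v : {ffun 'I_n -> V}) (i j : 'I_n),
    i != j -> v i = v j -> coch_fun v = 0;
  coch_equivariant : forall v : {ffun 'I_n -> V},
    alpha (coch_fun v) = coch_fun [ffun i => beta (v i)]
}.

(* Argument lists are indexed from 0.  [entry v j] is total in j : nat; its
   default value 0 (for n <= j) is never reached by the formulas below when
   the degrees of the cochains are positive. *)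
Definition entry (V : nmodType) (n : nat) (v : {ffun 'I_n -> V}) (j : nat) : V :=
  oapp v 0 (insub j).

Definition args (V : Type) (n : nat) (w : nat -> V) : {ffun 'I_n -> V} :=
  [ffun j : 'I_n => w j].

(* The n arguments x, w 0, w 1, ..., w (n - 2). *)
Definition cons_args (V : Type) (n : nat) (x : V) (w : nat -> V) :
    {ffun 'I_n -> V} :=
  args n (fun j => if j is j'.+1 then w j' else x).

(* The (r_1, ..., r_i)-shuffles: permutations increasing on each of the
   consecutive blocks of lengths r_1, ..., r_i.  The set is empty when N is
   not the sum of the block lengths. *)
Definition shuffles (N : nat) (r : seq nat) : {set 'S_N} :=
  [set tau : 'S_N | (sumn r == N) &&
    [forall i : 'I_N, forall j : 'I_N,
      (reshape_index r i == reshape_index r j) && (i < j)%N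
        ==> (tau i < tau j)%N]].

Definition bracketC (k : fieldType) (g : lmodType k) (L : homLie g)
    (V : lmodType k) (M : homLieRep L V) (n m : nat)
    (P : cochain (hr_beta M) (hl_alpha L) n)
    (Q : cochain (hr_beta M) (hl_alpha L) m)
    (v : {ffun 'I_(n + m) -> V}) : g :=
  let alpha := hl_alpha L in
  let beta := hr_beta M in
  let vp (tau : 'S_(n + m)) := entry [ffun i => v (tau i)] in
  \sum_(tau in shuffles (n + m) [:: m; 1; n.-1]%N)
    (-1) ^+ odd_perm tau *:
      P (cons_args n
          (hr_rho M (Q (args m (vp tau))) (iter m.-1 beta (vp tau m)))
          (fun j => iter m beta (vp tau (m + 1 + j)%N)))
  + (-1) ^+ (m * n) *:
    (\sum_(tau in shuffles (n + m) [:: n; m]%N)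
       (-1) ^+ odd_perm tau *:
         hl_bracket L
           (iter m.-1 alpha (P (args n (vp tau))))
           (iter n.-1 alpha (Q (args m (fun j => vp tau (n + j)%N))))
     - \sum_(tau in shuffles (n + m) [:: n; 1; m.-1]%N)
         (-1) ^+ odd_perm tau *:
           Q (cons_args m
               (hr_rho M (P (args n (vp tau))) (iter n.-1 beta (vp tau n)))
               (fun j => iter n beta (vp tau (n + 1 + j)%N)))).

(* The coboundary of the hom-Lie algebra L with coefficients in (V, beta, rho).
   [bump i] enumerates the naturals other than i, and, for i < j,
   [bump j \o bump i] those other than i and j.  Indexing from 0 changes
   (-1)^(i+1) to (-1)^i and preserves (-1)^(i+j). *)
Definition coboundary (k : fieldType) (g : lmodType k) (L : homLie g)
    (V : lmodType k) (M : homLieRep L V) (n : nat)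
    (P : cochain (hl_alpha L) (hr_beta M) n) (x : {ffun 'I_n.+1 -> g}) : V :=
  let alpha := hl_alpha L in
  \sum_(i < n.+1)
    (-1) ^+ i *: hr_rho M (iter n.-1 alpha (x i))
                   (P (args n (fun l => entry x (bump i l))))
  + \sum_(i < n.+1) \sum_(j < n.+1 | (i < j)%N)
      (-1) ^+ (i + j) *:
        P (cons_args n (hl_bracket L (x i) (x j))
             (fun l => alpha (entry x (bump j (bump i l))))).

Section OoperatorConstructions.
Variables (k : fieldType) (g : lmodType k) (L : homLie g).
Variables (V : lmodType k) (M : homLieRep L V) (T : Ooperator M).

Local Notation alpha := (hl_alpha L).
Local Notation beta := (hr_beta M).
Local Notation br := (hl_bracket L).
Local Notation rho := (hr_rho M).

Definition subadj_bracket (v w : V) : V := rho (T v) w - rho (T w) v.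

Fact subadj_bracket_bilinear : bilinear_for *:%R *:%R subadj_bracket.
Proof.
split=> w a u v; rewrite /subadj_bracket /= (linearP T) linearPl linearPr /= scalerBr.
  by rewrite opprD addrACA.
by rewrite opprD addrACA.
Qed.

HB.instance Definition _ := bilinear_isBilinear.Build k V V V *:%R *:%R
  subadj_bracket subadj_bracket_bilinear.

Fact subadj_skew v w : subadj_bracket v w = - subadj_bracket w v.
Proof. by rewrite /subadj_bracket opprB. Qed.

Fact subadj_mult v w :
  beta (subadj_bracket v w) = subadj_bracket (beta v) (beta w).
Proof. by rewrite /subadj_bracket !oo_comm !hr_mult linearB. Qed.

Fact subadj_morph v w : T (subadj_bracket v w) = br (T v) (T w).
Proof. by rewrite oo_bracket. Qed.

Fact subadj_jacobi u v w :
  subadj_bracket (beta u) (subadj_bracket v w)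
  + subadj_bracket (beta v) (subadj_bracket w u)
  + subadj_bracket (beta w) (subadj_bracket u v) = 0.
Proof.
have E a b c : subadj_bracket (beta a) (subadj_bracket b c) =
   (rho (alpha (T a)) (rho (T b) c) - rho (alpha (T a)) (rho (T c) b))
   - (rho (alpha (T b)) (rho (T c) a) - rho (alpha (T c)) (rho (T b) a)).
  by rewrite {1}/subadj_bracket subadj_morph hr_act oo_comm linearBr.
rewrite !E !opprB !addrA.
rewrite [LHS](ACl ((1*12)*(7*2)*(3*10)*(5*4)*(11*6)*(9*8)))/=.
by rewrite !subrr !addr0.
Qed.

Definition subadjacent : homLie V :=
  @HomLie k V subadj_bracket beta subadj_skew subadj_mult subadj_jacobi.

Definition rhoT (v : V) (x : g) : g := br (T v) x + T (rho x v).

Fact rhoT_bilinear : bilinear_for *:%R *:%R rhoT.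
Proof.
split=> w a u v; rewrite /rhoT /=.
  by rewrite (linearP T) linearPl linearPr linearP /= scalerDr addrACA.
by rewrite linearPl linearPr linearP /= scalerDr addrACA.
Qed.

HB.instance Definition _ := bilinear_isBilinear.Build k V g g *:%R *:%R
  rhoT rhoT_bilinear.

Fact rhoT_mult v x : rhoT (beta v) (alpha x) = alpha (rhoT v x).
Proof. by rewrite /rhoT !oo_comm hr_mult oo_comm linearD hl_mult. Qed.

Fact rhoT_act v w x :
  rhoT (subadj_bracket v w) (alpha x)
  = rhoT (beta v) (rhoT w x) - rhoT (beta w) (rhoT v x).
Proof.
have E a b : rhoT (beta a) (rhoT b x) =
    br (alpha (T a)) (br (T b) x)
    + T (rho (alpha (T a)) (rho x b) + rho (alpha (T b)) (rho x a)
         - rho (alpha x) (rho (T b) a)).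
  rewrite /rhoT linearDr linearDl /= -addrA -!oo_comm; congr (_ + _).
  rewrite oo_bracket -(raddfD T) /= oo_comm hr_act; congr (oo_fun T _).
  by rewrite !addrA [LHS](ACl (1*3*4*(5*2)))/= addrN addr0 oo_comm.
rewrite !E opprD addrACA -(raddfB T) {1}/rhoT subadj_morph; congr (_ + T _).
  have := hl_jacobi L (T v) (T w) x.
  rewrite [br x (T v)]hl_skew linearNr /= [br (alpha x) _]hl_skew.
  by move/eqP; rewrite subr_eq0 => /eqP.
rewrite linearBr !opprD opprK !addrA.
rewrite [RHS](ACl ((1*5)*(2*4)*(6*3)))/=.
by rewrite !subrr !add0r.
Qed.

Definition induced_rep : homLieRep subadjacent g :=
  @HomLieRep k V subadjacent g alpha rhoT rhoT_mult rhoT_act.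

Fact Ooperator_multilinear (i : 'I_1) (v : {ffun 'I_1 -> V}) :
  linear (fun x : V => T (finfun [eta v with i |-> x] ord0)).
Proof. by move=> a x y; rewrite !ffunE /= (ord1 i) eqxx linearP. Qed.

Fact Ooperator_alternating (v : {ffun 'I_1 -> V}) (i j : 'I_1) :
  i != j -> v i = v j -> T (v ord0) = 0.
Proof. by rewrite (ord1 i) (ord1 j) eqxx. Qed.

Fact Ooperator_equivariant (v : {ffun 'I_1 -> V}) :
  alpha (T (v ord0)) = T ([ffun i => beta (v i)] ord0).
Proof. by rewrite ffunE oo_comm. Qed.

Definition Ooperator_cochain : cochain beta alpha 1 :=
  Cochain Ooperator_multilinear Ooperator_alternating Ooperator_equivariant.

Definition deltaC (n : nat) (P : cochain beta alpha n) :
    {ffun 'I_n.+1 -> V} -> g :=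
  @coboundary k V subadjacent g induced_rep n P.

End OoperatorConstructions.

(* Main.v *)
(* Since T has degree 1, each of the three shuffle sums in the bracket of T and P
   is indexed by one or two positions: a (1,n)-shuffle is determined by its first
   value i and has sign (-1)^i, an (n,1)-shuffle by its last value i and has sign
   (-1)^(n-i), and a (1,1,n-1)-shuffle by the ordered pair of its first two values.
   The first two sums give the two summands of rho_T; in the third, the pairs (i, j)
   and (j, i) have opposite signs and combine into the sub-adjacent bracket. *)
Require Import Defs.
From mathcomp Require Import all_boot all_order perm all_algebra.
From mathcomp Require Import zify.

Set Implicit Arguments.
Unset Strict Implicit.
Unset Printing Implicit Defensive.

Import GRing.Theory.
Local Open Scope ring_scope.

(** * Permutations and shuffles with one position split off *)

(** Deleting [i] from the source and [t i] from the target, and renumbering both, leaves the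
    permutation [s]. *)
Lemma lift_perm_surj n (i : 'I_n.+1) (t : 'S_n.+1) :
  exists s, t = lift_perm i (t i) s.
Proof.
have tne k : t i != t (lift i k) by rewrite (inj_eq perm_inj) neq_lift.
(* The default [k] is never reached, by [tne]. *)
pose f k := odflt k (unlift (t i) (t (lift i k))).
have fE k : lift (t i) (f k) = t (lift i k).
  by rewrite /f; case: unliftP (tne k) => [j ->|->] //; rewrite eqxx.
have f_inj : injective f.
  by move=> a b eqf; apply: (@lift_inj _ i); apply: (@perm_inj _ t); rewrite -!fE eqf.
exists (perm f_inj); apply/permP=> k; case: (unliftP i k) => [j|] ->.
  by rewrite lift_perm_lift permE fE.
by rewrite lift_perm_id.
Qed.

Lemma lift_perm_inj n (i j j' : 'I_n.+1) (s s' : 'S_n) :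
  lift_perm i j s = lift_perm i j' s' -> j = j' /\ s = s'.
Proof.
move=> eqt; have eqj : j = j' by rewrite -(lift_perm_id i j s) eqt lift_perm_id.
split=> //; apply/permP=> k; apply: (@lift_inj _ j).
by rewrite -(lift_perm_lift i) eqt {1}eqj lift_perm_lift.
Qed.

Lemma lt_lift n (i : 'I_n.+1) (a b : 'I_n) : (lift i a < lift i b)%N = (a < b)%N.
Proof. by rewrite /= /bump; lia. Qed.

Lemma shufflesP N r (t : 'S_N) :
  reflect (sumn r = N /\ forall i j : 'I_N,
             reshape_index r i = reshape_index r j -> (i < j)%N -> (t i < t j)%N)
          (t \in shuffles N r).
Proof.
rewrite inE; apply: (iffP andP) => -[/eqP sr H]; split=> //.
  by move=> i j rij lij; move/forallP/(_ i)/forallP/(_ j): H; rewrite rij eqxx lij.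
by apply/forallP=> i; apply/forallP=> j; apply/implyP=> /andP[/eqP]; apply: H.
Qed.

Lemma shuffles_one N : shuffles N [:: N] = [set (1%g : 'S_N)].
Proof.
have r0 (i : 'I_N) : reshape_index [:: N] i = 0%N.
  by rewrite /reshape_index /=; have := ltn_ord i; rewrite -subn_eq0 => ->.
apply/setP=> t; rewrite in_set1; apply/shufflesP/eqP; last first.
  by move=> ->; rewrite /= addn0; split=> // i j _; rewrite !perm1.
case=> _ H; have tlt (i j : 'I_N) : (i < j)%N -> (t i < t j)%N by apply: H; rewrite !r0.
(* An increasing [t] satisfies [i <= t i] by induction from the bottom and [t i <= i] by induction
   from the top; the second bound is written for an induction on [N - i]. *)
suff tle (i : 'I_N) : (i <= t i)%N /\ (N - i <= N - t i)%N.
  by apply/permP=> i; apply/val_inj; rewrite perm1 /=; have := tle i; have := ltn_ord (t i);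
     have := ltn_ord i; lia.
split.
  case: i => i; elim: i => // i IHi iN /=.
  have iN' := ltnW iN; apply: leq_ltn_trans (IHi iN') _; exact: tlt.
have [d Ed] : exists d, (N - i)%N = d by eexists.
rewrite Ed; elim: d i Ed => // d IHd i Ed.
have [iN|] := ltnP i.+1 N; last by have := ltn_ord (t i); lia.
have /IHd : (N - Ordinal iN)%N = d by rewrite /=; lia.
by have := tlt i (Ordinal iN) (leqnn _); have := ltn_ord (t (Ordinal iN)); lia.
Qed.

(** Position 0 is alone in its block, so its value [i] is free; the other block indices only shift
    by one. *)
Lemma mem_shuffles_cons1 N r i (s : 'S_N) :
  (lift_perm ord0 i s \in shuffles N.+1 (1%N :: r)) = (s \in shuffles N r).
Proof.
have rS j : reshape_index (1%N :: r) j.+1 = (reshape_index r j).+1 by [].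
apply/shufflesP/shufflesP=> -[sr H]; split.
- by case: sr.
- move=> a b rab lab; have := H (lift ord0 a) (lift ord0 b).
  by rewrite !lift_perm_lift !lt_lift; apply=> //; rewrite !lift0 !rS rab.
- by rewrite /= sr.
- move=> a b; case: (unliftP ord0 a) => [a'|] ->; case: (unliftP ord0 b) => [b'|] -> //.
  by rewrite !lift_perm_lift !lt_lift !lift0 !rS => -[]; apply: H.
Qed.

(** The last position is alone in its block. The empty third block is the one of length [n.-1] in
    [bracketC] when the first cochain has degree 1. *)
Lemma mem_shuffles_last N i (s : 'S_N) :
  (lift_perm ord_max i s \in shuffles N.+1 [:: N; 1%N; 0%N])
  = (s \in shuffles N [:: N]).
Proof.
have r0 (a : 'I_N) : reshape_index [:: N; 1%N; 0%N] (lift ord_max a) = 0%N.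
  by rewrite lift_max /reshape_index /=; have := ltn_ord a; rewrite -subn_eq0 => ->.
have r1 (a : 'I_N) : reshape_index [:: N] a = 0%N.
  by rewrite /reshape_index /=; have := ltn_ord a; rewrite -subn_eq0 => ->.
have rm : reshape_index [:: N; 1%N; 0%N] N = 1%N.
  by rewrite /reshape_index /= subSnn.
apply/shufflesP/shufflesP=> -[sr H]; split.
- by rewrite /= addn0.
- move=> a b rab lab; have := H (lift ord_max a) (lift ord_max b).
  by rewrite !lift_perm_lift !lt_lift; apply=> //; rewrite !r0.
- by rewrite /= addn1.
- move=> a b; case: (unliftP ord_max a) => [a'|] ->; case: (unliftP ord_max b) => [b'|] ->.
  + by rewrite !lift_perm_lift !lt_lift => _; apply: H; rewrite !r1.
  + by rewrite r0 rm.
  + by rewrite r0 rm.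
  + by rewrite ltnn.
Qed.

(** Reindexing along the bijection sending a pair [(i, s)] to [lift_perm i0 i s]. *)
Lemma big_lift_perm (W : nmodType) N (i0 : 'I_N.+1) (A : {set 'S_N})
    (B : {set 'S_N.+1}) (F : 'S_N.+1 -> W) :
  (forall i s, (lift_perm i0 i s \in B) = (s \in A)) ->
  \sum_(t in B) F t = \sum_(i < N.+1) \sum_(s in A) F (lift_perm i0 i s).
Proof.
move=> AB; rewrite pair_big /=.
have -> : B = [set lift_perm i0 p.1 p.2 | p : 'I_N.+1 * 'S_N in [pred p | p.2 \in A]].
  apply/setP=> t; apply/idP/imsetP=> [tB|[[i s] /= sA ->]]; last by rewrite AB.
  have [s Es] := lift_perm_surj i0 t.
  by exists (t i0, s) => //=; rewrite inE /= -(AB (t i0)) -Es.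
by rewrite big_imset //= => -[i s] [j u] _ _ /= /lift_perm_inj[-> ->].
Qed.

Lemma sum_shuffles1 (W : nmodType) n (F : 'S_n.+1 -> W) :
  \sum_(t in shuffles n.+1 [:: 1; n]%N) F t
  = \sum_(i < n.+1) F (lift_perm ord0 i 1%g).
Proof.
rewrite (big_lift_perm _ (mem_shuffles_cons1 [:: n])).
by apply: eq_bigr => i _; rewrite shuffles_one big_set1.
Qed.

Lemma sum_shuffles11 (W : nmodType) n (F : 'S_n.+2 -> W) :
  \sum_(t in shuffles n.+2 [:: 1; 1; n]%N) F t
  = \sum_(i < n.+2) \sum_(j < n.+1)
      F (lift_perm ord0 i (lift_perm ord0 j 1%g)).
Proof.
rewrite (big_lift_perm _ (mem_shuffles_cons1 [:: 1; n]%N)).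
by apply: eq_bigr => i _; rewrite sum_shuffles1.
Qed.

Lemma sum_shuffles_last (W : nmodType) n (F : 'S_n.+1 -> W) :
  \sum_(t in shuffles n.+1 [:: n; 1; 0]%N) F t
  = \sum_(i < n.+1) F (lift_perm ord_max i 1%g).
Proof.
rewrite (big_lift_perm _ (@mem_shuffles_last n)).
by apply: eq_bigr => i _; rewrite shuffles_one big_set1.
Qed.

(** * Argument lists and sums over pairs of distinct indices *)

Lemma entry_ord (V : nmodType) n (v : {ffun 'I_n -> V}) (i : 'I_n) :
  entry v i = v i.
Proof. by rewrite /entry valK. Qed.

Lemma entry_lift_perm (V : nmodType) n (v : {ffun 'I_n.+1 -> V})
    (i0 i : 'I_n.+1) (s : 'S_n) (k : 'I_n) :
  entry [ffun l => v (lift_perm i0 i s l)] (bump i0 k) = v (lift i (s k)).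
Proof. by rewrite (entry_ord _ (lift i0 k)) ffunE lift_perm_lift. Qed.

Lemma eq_args (V : Type) n (w w' : nat -> V) :
  (forall j : 'I_n, w j = w' j) -> args n w = args n w'.
Proof. by move=> ww'; apply/ffunP=> j; rewrite !ffunE. Qed.

Lemma eq_cons_args (V : Type) n (x : V) (w w' : nat -> V) :
  (forall j : 'I_n, w j = w' j) -> cons_args n.+1 x w = cons_args n.+1 x w'.
Proof.
by move=> ww'; apply: eq_args; case=> -[|j] //= jn; apply: (ww' (Ordinal (jn : (j < n)%N))).
Qed.

Lemma cochain_cons_argsB (k : fieldType) (V g : lmodType k) (beta : V -> V)
    (alpha : g -> g) n (P : cochain beta alpha n.+1) (w : nat -> V) (x y : V) :
  P (cons_args n.+1 (x - y) w) = P (cons_args n.+1 x w) - P (cons_args n.+1 y w).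
Proof.
(* Multilinearity is stated for the update of one slot, so each list becomes an update of a common
   one, whose overwritten entry 0 is arbitrary. *)
have E z : cons_args n.+1 z w =
    finfun [eta cons_args n.+1 0 w with ord0 |-> z].
  apply/ffunP=> i; rewrite !ffunE /= ffunE.
  by case: (unliftP ord0 i) => [j|] ->.
rewrite (E (x - y)) (E x) (E y); have := coch_multilinear P ord0 (cons_args n.+1 0 w) (-1) y x.
by rewrite /= !scaleN1r ![- _ + _]addrC.
Qed.

Lemma sum_neq_lt (W : nmodType) n (F : 'I_n -> 'I_n -> W) :
  \sum_i \sum_(j | j != i) F i j
  = \sum_(i < n) \sum_(j < n | (i < j)%N) (F i j + F j i).
Proof.
under [RHS]eq_bigr do rewrite big_split /=.
rewrite big_split /= [X in _ + X](exchange_big_dep predT) //= -big_split /=.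
apply: eq_bigr => i _; rewrite (bigID (fun j : 'I_n => (i < j)%N)) /=.
congr (_ + _); apply: eq_bigl => j; rewrite -val_eqE /=; lia.
Qed.

Lemma sum_neq_lift (W : nmodType) n (i : 'I_n.+1) (F : 'I_n.+1 -> W) :
  \sum_(j | j != i) F j = \sum_(j < n) F (lift i j).
Proof.
rewrite big_mkcond (bigD1_ord i) //= eqxx add0r.
by apply: eq_bigr => j _; rewrite eq_sym neq_lift.
Qed.

(** * The differential as three sums, matched with those of the bracket *)

Section Comparison.
Variables (k : fieldType) (g : lmodType k) (L : homLie g).
Variables (V : lmodType k) (M : homLieRep L V) (T : Ooperator M) (n : nat).
Variables (P : cochain (hr_beta M) (hl_alpha L) n.+1) (v : {ffun 'I_n.+2 -> V}).

Local Notation alpha := (hl_alpha L).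
Local Notation beta := (hr_beta M).
Local Notation br := (hl_bracket L).
Local Notation rho := (hr_rho M).

Let P1 i := P (args n.+1 (fun l => entry v (bump i l))).

(* The min/max form makes the omission of positions a and b symmetric in a, b. *)
Let P2 a b x := P (cons_args n.+1 x
  (fun l => beta (entry v (bump (maxn a b) (bump (minn a b) l))))).

Lemma Ooperator_iter m x : T (iter m beta x) = iter m alpha (T x).
Proof. by elim: m => //= m <-; rewrite oo_comm. Qed.

Lemma deltaCE :
  deltaC T P v =
    \sum_(i < n.+2) (-1) ^+ i *: T (rho (P1 i) (iter n beta (v i)))
  + \sum_(i < n.+2) (-1) ^+ i *: br (iter n alpha (T (v i))) (P1 i)
  + \sum_(i < n.+2) \sum_(j < n.+2 | (i < j)%N)
      (-1) ^+ (i + j) *: P2 i j (subadj_bracket T (v i) (v j)).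
Proof.
rewrite -[X in _ = X + _]big_split /deltaC /coboundary /=; congr (_ + _).
  apply: eq_bigr => i _; rewrite -scalerDr; congr (_ *: _).
  by rewrite /rhoT Ooperator_iter addrC.
apply: eq_bigr => i _; apply: eq_bigr => j lij; congr (_ *: _).
by rewrite /P2 (maxn_idPr (ltnW lij)) (minn_idPl (ltnW lij)).
Qed.

Lemma sum_subadj_bracket :
  \sum_(i < n.+2) \sum_(j < n.+2 | (i < j)%N)
      (-1) ^+ (i + j) *: P2 i j (subadj_bracket T (v i) (v j))
  = - \sum_(i < n.+2) \sum_(j < n.+1)
      (-1) ^+ (odd i (+) odd j)
        *: P2 i (lift i j) (rho (T (v i)) (v (lift i j))).
Proof.
(* The summand [j < i] in the exponent makes the sign change when distinct [i] and [j] are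
   exchanged. *)
pose F (i j : 'I_n.+2) :=
  (-1) ^+ ((j < i) + i + j) *: P2 i j (rho (T (v i)) (v j)).
transitivity (\sum_i \sum_(j | j != i) F i j); last first.
  rewrite -sumrN; apply: eq_bigr => i _; rewrite sum_neq_lift -sumrN.
  apply: eq_bigr => j _; rewrite /F -scaleNr; congr (_ *: _).
  (* Whether or not [lift i j] exceeds [i], the exponent in [F i (lift i j)] has the parity of
     [i + j + 1]. *)
  rewrite -signr_odd -signrN -oddD; congr (_ ^+ nat_of_bool _).
  by rewrite /= /bump; lia.
rewrite sum_neq_lt; apply: eq_bigr => i _; apply: eq_bigr => j lij.
rewrite /F lij ltnNge (ltnW lij) /= add0n /P2 /subadj_bracket cochain_cons_argsB.
rewrite scalerBr (maxnC j) (minnC j) -scaleNr -[- (_ ^+ _)]mulN1r -exprS.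
by congr (_ + (-1) ^+ _ *: _); lia.
Qed.

End Comparison.

Theorem proposition3p13 (k : fieldType) (char0 : [pchar k] =i pred0)
    (g : lmodType k) (L : homLie g) (V : lmodType k) (M : homLieRep L V)
    (T : Ooperator M) (n : nat) (n_ge1 : (1 <= n)%N)
    (P : cochain (hr_beta M) (hl_alpha L) n) (v : {ffun 'I_n.+1 -> V}) :
  deltaC T P v = (-1) ^+ n *: bracketC (Ooperator_cochain T) P v.
Proof.
case: n n_ge1 P v => // n _ P v.
rewrite deltaCE sum_subadj_bracket /bracketC -addrA scalerDr scalerA muln1 -exprD.
(* As [T] has degree 1, the sign inside the bracket equals the global sign, and the two cancel; only
   the first shuffle sum keeps a sign. *)
rewrite -[(-1) ^+ (_ + _)]signr_odd addnn odd_double expr0 scale1r.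
rewrite [in RHS]sum_shuffles_last [in RHS]sum_shuffles1 [in RHS]sum_shuffles11.
congr (_ + (_ - _)).
- rewrite scaler_sumr; apply: eq_bigr => i _; rewrite scalerA; congr (_ *: _).
    (* The shuffle sign contains the same power of -1 as the global sign, so just the sign of [i]
       remains. *)
    rewrite odd_lift_perm odd_perm1 addbF signr_addb !signr_odd mulrA.
    by rewrite -expr2 sqrr_sign mul1r.
  rewrite /= ffunE /=; congr (T (hr_rho M (P _) (iter n _ _))).
    apply: eq_args => l.
    by rewrite -{2}[l : nat]lift_max entry_lift_perm perm1 (entry_ord _ (lift i l)).
  by rewrite (entry_ord _ ord_max) ffunE lift_perm_id.
- apply: eq_bigr => i _; congr (_ *: hl_bracket L (iter n _ (T _)) (P _)).
  - by rewrite odd_lift_perm odd_perm1 addbF signr_odd.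
  - by rewrite ffunE (entry_ord _ ord0) ffunE lift_perm_id.
  - apply: eq_args => l.
    by rewrite -[(1 + l)%N]/(bump 0 l) entry_lift_perm perm1 (entry_ord _ (lift i l)).
- apply: eq_bigr => i _; apply: eq_bigr => j _.
  rewrite !odd_lift_perm odd_perm1 addbF /=; congr (_ *: P _).
  have v1 : entry [ffun l => v (lift_perm ord0 i (lift_perm ord0 j 1%g) l)] 1
      = v (lift i j).
    by rewrite -[1%N]/(bump 0 (@ord0 n)) entry_lift_perm lift_perm_id.
  rewrite ffunE (entry_ord _ ord0) ffunE lift_perm_id v1.
  apply: eq_cons_args => l; congr (hr_beta M _).
  rewrite -[(1 + 1 + l)%N]/(bump 0 (bump 0 l)) (entry_lift_perm _ _ _ _ (lift ord0 l)).
  rewrite lift_perm_lift perm1 -(entry_ord v); congr (entry v _).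
  (* [lift i (lift j l)] and the nested [bump] of [P2] both list, in increasing order, the positions
     other than [i] and [lift i j]. *)
  by rewrite /= /bump; lia.
Qed.
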